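(* Let $1\le k\le n$. Let $S_1$ and $S_2$ be two $k$-out-of-$n$ systems with one cold standby unit each, with lifetimes $T_1$ and $T_2$; let $X_1,\ldots,X_n$ and $Y_1,\ldots,Y_n$ be the lifetimes of the active components of $S_1$ and $S_2$, respectively, and let $Z_i$ be the lifetime of the standby unit of $S_i$, $i=1,2$. Let $X_1,\ldots,X_n,Z_1,Z_2$ be discrete random variables taking only non-negative integers as values. If $(X_1,\ldots,X_n)\stackrel{d}{=}(Y_1,\ldots,Y_n)$, the random vector $(X_1,\ldots,X_n)$ and $Z_1$ are independent, the random vector $(Y_1,\ldots,Y_n)$ and $Z_2$ are independent, and $Z_1\le_{st}Z_2$, then: (a) $T_1\le_{st}T_2$ and, in consequence, $E\,T_1\le E\,T_2$; (b) for any $t$ such that $P(X_{1:n}>t)>0$, $[T_1\mid X_{1:n}>t]\le_{st}[T_2\mid Y_{1:n}>t]$ and, in consequence, $E(T_1-t\mid X_{1:n}>t)\le E(T_2-t\mid Y_{1:n}>t)$; (c) for any $t$ such that $P(X_{n-k+1:n}>t)>0$, $[T_1\mid X_{n-k+1:n}>t]\le_{st}[T_2\mid Y_{n-k+1:n}>t]$ and, in consequence, $E(T_1-t\mid X_{n-k+1:n}>t)\le E(T_2-t\mid Y_{n-k+1:n}>t)$.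
   Context: Expectations may be infinite. For $W_1,\ldots,W_n$ let $W_{1:n}\le\cdots\le W_{n:n}$ be the order statistics and $W_{n+1:n}:=\infty$. The system lifetimes are $T_1=\min(X_{n-k+1:n}+Z_1,\,X_{n-k+2:n})$ and $T_2=\min(Y_{n-k+1:n}+Z_2,\,Y_{n-k+2:n})$. $X\le_{st}Y$ means $P(X>s)\le P(Y>s)$ for all $s$; $\stackrel{d}{=}$ is equality in distribution. For an event $A$ with positive probability, $[X\mid A]$ denotes a random variable having the conditional distribution of $X$ given $A$. *)

(* Defs.v *)
From mathcomp Require Import all_boot all_order all_algebra.
From mathcomp Require Import all_classical all_reals all_analysis.

Set Implicit Arguments.
Unset Strict Implicit.
Unset Printing Implicit Defensive.

Import Order.TTheory GRing.Theory Num.Theory.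

Local Open Scope classical_set_scope.
Local Open Scope ring_scope.
Local Open Scope ereal_scope.

Section lifetimes.
Context {T : Type} {R : realType}.

(* W_{j:n} for 1 <= j <= n (the index is 1-based); beyond the range nth returns
   its default +oo, which is the convention W_{n+1:n} = oo. *)
Definition ordstat (n : nat) (W : 'I_n -> T -> R) (j : nat) (w : T) : \bar R :=
  nth +oo (sort <=%O [seq (W i w)%:E | i <- enum 'I_n]) j.-1.

Lemma ordstat_last (n : nat) (W : 'I_n -> T -> R) (w : T) :
  ordstat W n.+1 w = +oo.
Proof. by rewrite /ordstat nth_default// size_sort size_map size_enum_ord. Qed.

Definition lifetime (n k : nat) (W : 'I_n -> T -> R) (Z : T -> R) (w : T) :
    \bar R :=
  Order.min (ordstat W (n - k + 1)%N w + (Z w)%:E) (ordstat W (n - k + 2)%N w).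

Definition rvec (n : nat) (W : 'I_n -> T -> R) (w : T) : n.-tuple R :=
  [tuple W i w | i < n].

End lifetimes.

Section laws.
Context {d : measure_display} {T : measurableType d} {R : realType}.
Implicit Types (P : probability T R) (A B : set T).

Definition nat_valued P (X : T -> R) : Prop :=
  {ae P, forall w, exists m : nat, X w = m%:R%R}.

(* Only measurable sets are tested: the library's measures are functions on all
   sets, with unconstrained values off the sigma-algebra. *)
Definition eq_dist {d' : measure_display} {U : measurableType d'} P
    (X Y : T -> U) : Prop :=
  forall C : set U, measurable C -> P (X @^-1` C) = P (Y @^-1` C).

Definition independent {d1 d2 : measure_display}
    {U1 : measurableType d1} {U2 : measurableType d2} P
    (X : T -> U1) (Y : T -> U2) : Prop :=
  forall (C : set U1) (D : set U2), measurable C -> measurable D ->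
    P (X @^-1` C `&` Y @^-1` D) = P (X @^-1` C) * P (Y @^-1` D).

(* X <=_st Y, where X is considered under mu and Y under nu. *)
Definition st_le (mu nu : set T -> \bar R) (X Y : T -> \bar R) : Prop :=
  forall s : R, mu [set w | s%:E < X w] <= nu [set w | s%:E < Y w].

(* P(. | A): the law of X under cond_prob P A is that of [X | A], and the
   integral of X against it is E(X | A). Meaningful only when 0 < P A. *)
Definition cond_prob P A : set T -> \bar R := fun B => P (B `&` A) / P A.

Lemma cond_probE P A (mA : measurable A) :
  0 < P A -> cond_prob P A = mnormalize (mrestr P mA) P.
Proof.
move=> PA0; have PAfin : P A \is a fin_num by exact: fin_num_measure.
apply/funext => B; rewrite /cond_prob /mnormalize /= /mrestr setTI.
rewrite gt_eqF//= ifF; last by apply/eqP => PAoo; rewrite PAoo in PAfin.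
by rewrite -[X in _ / X](fineK PAfin) inver ifF// gt_eqF// fine_gt0// PA0 ltey_eq PAfin.
Qed.

End laws.

(* Main.v *)
Require Import Defs.
From mathcomp Require Import all_boot all_order all_algebra.
From mathcomp Require Import all_classical all_reals all_analysis.
From mathcomp Require Import measurable_realfun zify.

(* Split according to the value m of W_{n-k+1:n}. By independence, the event
   {lifetime > s} intersected with any event on the component lifetimes has
   probability sum_m P(W_{n-k+1:n} = m, W_{n-k+2:n} > s, ...) P(Z > s - m), and
   each term grows when Z grows stochastically. Both conditioning events are
   events on the component lifetimes, with the same probability for the two
   systems, so this gives all the stochastic comparisons; the inequalities
   between expectations follow by integrating the tail probabilities. *)

Import Order.TTheory GRing.Theory Num.Theory.
Local Open Scope classical_set_scope.
Local Open Scope ring_scope.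
Local Open Scope ereal_scope.

(** * Order statistics *)

Lemma ordstat_mem (T : Type) (R : realType) (n : nat) (W : 'I_n -> T -> R) j w :
  (0 < j <= n)%N -> exists i, ordstat W j w = (W i w)%:E.
Proof.
move=> /andP[j0 jn].
have: ordstat W j w \in sort <=%O [seq (W i w)%:E | i <- enum 'I_n].
  by rewrite /ordstat mem_nth// size_sort size_map size_enum_ord prednK.
by rewrite mem_sort => /mapP[i _ ->]; exists i.
Qed.

(** In the sorted list the entries at most [s] form an initial segment, so the entry at 0-based
    position [j.-1] exceeds [s] exactly when that segment has length at most [j.-1]. *)
Lemma ordstat_gt (T : Type) (R : realType) (n : nat) (W : 'I_n -> T -> R) j w
    (s : R) :
  (0 < j)%N ->
  (s%:E < ordstat W j w) = (count (fun i => (W i w <= s)%R) (enum 'I_n) < j)%N.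
Proof.
move=> j0; rewrite /ordstat.
set l := [seq _ | i <- _].
have srt : sorted <=%O (sort <=%O l) by exact: sort_le_sorted.
have -> : count (fun i => (W i w <= s)%R) (enum 'I_n)
          = count (fun x => x <= s%:E) (sort <=%O l).
  by rewrite count_sort /l [RHS]count_map; apply: eq_count => i;
    rewrite /= lee_fin.
rewrite -[in RHS](prednK j0) ltnS; set c := count _ _.
have [cj|jc] := leqP.
  have [js|sj] := ltnP j.-1 (size (sort <=%O l)).
    by apply: nth_count_gt => //; rewrite cj.
  (* Out of range, the default [+oo] exceeds every real [s]. *)
  by rewrite nth_default// ltry.
by apply/negbTE; rewrite -leNgt; exact: nth_count_le.
Qed.

(** Lets hypotheses on the law of [rvec W] and on its independence bear on order statistics. *)
Lemma ordstat_rvec (T : Type) (R : realType) (n : nat) (W : 'I_n -> T -> R)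
    j w :
  ordstat W j w = ordstat (fun i (x : n.-tuple R) => tnth x i) j (rvec W w).
Proof.
rewrite /ordstat; congr nth; congr sort; apply: eq_map => i.
by rewrite tnth_mktuple.
Qed.

(** Open upper rays generate the sigma-algebra, and by [ordstat_gt] the preimage of such a ray is a
    sublevel set of a finite sum [h] of indicators. *)
Lemma measurable_ordstat d (T : measurableType d) (R : realType) (n : nat)
    (W : 'I_n -> T -> R) j : (0 < j)%N ->
  (forall i, measurable_fun setT (W i)) -> measurable_fun setT (ordstat W j).
Proof.
move=> j0 mW mT; apply: (measurability _ (ErealGenOInfty.measurableE R)) => //.
move=> _ [_ [s ->] <-]; rewrite setTI.
pose h w : R := (\sum_(i <- enum 'I_n) \1_(W i @^-1` `]-oo, s]) w)%R.
have hE w : h w = (count (fun i => (W i w <= s)%R) (enum 'I_n))%:R.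
  rewrite /h -sum1_count natr_sum [RHS]big_mkcond; apply: eq_bigr => i _.
  rewrite indicE; case: ifPn => Ws.
    by rewrite mem_set//= in_itv.
  by rewrite memNset//= in_itv; exact/negP.
have -> : ordstat W j @^-1` `]s%:E, +oo[ = h @^-1` `]-oo, j%:R[.
  by apply/seteqP; split => w;
    rewrite /= !in_itv /= andbT hE ltr_nat ordstat_gt.
have mh : measurable_fun setT h.
  apply: measurable_sum => i; apply: measurable_indic.
  by rewrite -[X in measurable X]setTI; exact: mW.
by rewrite -[X in measurable X]setTI; exact: mh.
Qed.

(** * Tail comparison by slicing *)

(** Here [h1] and [h2] stand for the two order statistics in the lifetime and [C] for the
    conditioning event; all are read off [V], so that independence from [Z] factors every slice. *)
Lemma prob_standby_le d d' (Omega : measurableType d) (U : measurableType d')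
    (R : realType) (P : probability Omega R) (V1 V2 : Omega -> U)
    (Z1 Z2 : {RV P >-> R}) (h1 h2 : U -> \bar R) (C : set U) (s : R) :
  measurable_fun setT V1 -> measurable_fun setT V2 ->
  measurable_fun setT h1 -> measurable_fun setT h2 -> measurable C ->
  {ae P, forall w, exists m : nat, h1 (V1 w) = m%:R%:E} ->
  eq_dist P V1 V2 -> independent P V1 Z1 -> independent P V2 Z2 ->
  st_le P P (EFin \o Z1) (EFin \o Z2) ->
  P ([set w | s%:E < Order.min (h1 (V1 w) + (Z1 w)%:E) (h2 (V1 w))]
      `&` V1 @^-1` C) <=
  P ([set w | s%:E < Order.min (h1 (V2 w) + (Z2 w)%:E) (h2 (V2 w))]
      `&` V2 @^-1` C).
Proof.
move=> mV1 mV2 mh1 mh2 mC natV1 eqV iVZ1 iVZ2 leZ.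
pose D m := C `&` ([set u | s%:E < h2 u] `&` h1 @^-1` [set m%:R%:E]) : set U.
have mD m : measurable (D m).
  apply: measurableI => //; apply: measurableI.
    by rewrite -[X in measurable X]setTI; exact: emeasurable_fun_o_infty.
  by rewrite -[X in measurable X]setTI; exact: mh1.
(* On the slice [h1 = m], the condition [s < m + Z] reads [Z > s - m], an event of [Z] alone. *)
pose F (V : Omega -> U) (Z : Omega -> R) m :=
  V @^-1` D m `&` Z @^-1` `](s - m%:R)%R, +oo[.
pose E (V : Omega -> U) (Z : Omega -> R) :=
  [set w | s%:E < Order.min (h1 (V w) + (Z w)%:E) (h2 (V w))] `&` V @^-1` C.
have FE V Z m w : F V Z m w <-> E V Z w /\ h1 (V w) = m%:R%:E.
  split=> [[[CV [/= sh2 h1m]]]|[[/= + CV] h1m]].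
    rewrite /= in_itv /= andbT => sZ; split => //; split => //=.
    by rewrite lt_min sh2 h1m -EFinD lte_fin -ltrBlDl sZ.
  rewrite /F /= in_itv /= andbT lt_min h1m -EFinD lte_fin -ltrBlDl.
  by move=> /andP[sZ sh2].
have mF (V : Omega -> U) (Z : {RV P >-> R}) m :
    measurable_fun setT V -> measurable (F V Z m).
  move=> mV; apply: measurableI.
    by rewrite -[X in measurable X]setTI; exact: mV.
  exact: measurable_funPTI.
have mE (V : Omega -> U) (Z : {RV P >-> R}) :
    measurable_fun setT V -> measurable (E V Z).
  move=> mV; apply: measurableI; last first.
    by rewrite -[X in measurable X]setTI; exact: mV.
  rewrite -[X in measurable X]setTI; apply: emeasurable_fun_o_infty => //.
  apply: measurable_mine; last exact: measurableT_comp.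
  apply: emeasurable_funD; first exact: measurableT_comp.
  exact/measurable_EFinP.
have mUF (V : Omega -> U) (Z : {RV P >-> R}) :
    measurable_fun setT V -> measurable (\bigcup_m F V Z m).
  by move=> mV; apply: bigcup_measurable => m _; exact: mF.
have PF (V : Omega -> U) (Z : {RV P >-> R}) :
    measurable_fun setT V -> independent P V Z ->
    P (\bigcup_m F V Z m) = \sum_(m <oo) P (V @^-1` D m) *
      P (Z @^-1` `](s - m%:R)%R, +oo[).
  move=> mV iVZ; rewrite measure_semi_bigcup; last 3 first.
  - by move=> m; exact: mF.
  (* The slices are disjoint, as [h1 (V w)] determines [m]. *)
  - move=> i j _ _ [w [/FE[_ hi] /FE[_ +]]].
    by rewrite hi => -[] /eqP; rewrite eqr_nat => /eqP.
  - exact: mUF.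
  by apply: eq_eseriesr => m _; exact: iVZ.
have [N [mN N0 subN]] := natV1.
(* Off the null set [N] the slices exhaust the event of the first system. *)
have EN : E V1 Z1 `<=` (\bigcup_m F V1 Z1 m) `|` N.
  move=> w Ew.
  have [[m h1m]|nom] := pselect (exists m : nat, h1 (V1 w) = m%:R%:E).
    by left; exists m => //; exact/FE.
  by right; exact: subN.
apply: (@le_trans _ _ (P ((\bigcup_m F V1 Z1 m) `|` N))).
  apply: le_measure; rewrite ?inE//; first exact: mE.
  by apply: measurableU => //; exact: mUF.
have -> : P ((\bigcup_m F V1 Z1 m) `|` N) = P (\bigcup_m F V1 Z1 m).
  by rewrite measureU0//; exact: mUF.
rewrite PF//.
(* For the second system, the inclusion of the slices in the event gives the required direction. *)
apply: (@le_trans _ _ (P (\bigcup_m F V2 Z2 m))); last first.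
  apply: le_measure; rewrite ?inE//; [exact: mUF|exact: mE|].
  by move=> w [m _ /FE[]].
rewrite (PF V2 Z2)//.
apply: lee_nneseries => [m _ _|m _]; first exact: mule_ge0.
rewrite eqV// lee_wpmul2l//.
have := leZ (s - m%:R)%R; congr (P _ <= P _); apply/seteqP; split => w /=;
  by rewrite in_itv /= andbT lte_fin.
Qed.

(** * Expectations from tail probabilities *)

(* The library's expectation_cdf_ccdf assumes U integrable; here both sides may
   be infinite (and oo - oo = -oo on both sides). *)
Lemma expectation_posneg_tail d (T : measurableType d) (R : realType)
    (P : probability T R) (U : {RV P >-> R}) :
  'E_P[U] = \int[lebesgue_measure]_(r in `[0%R, +oo[) ccdf U r -
            \int[lebesgue_measure]_(r in `]-oo, 0%R[) cdf U r.
Proof.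
have Upos := @ge0_expectation_ccdf _ _ _ P (U^\+)%R (funrpos_ge0 _).
have Uneg := @le0_expectation_cdf _ _ _ P (- U^\-)%R.
rewrite expectation_def integralE; congr (_ - _).
  transitivity (\int[P]_w ((U^\+)%R w)%:E).
    by apply: eq_integral => w _; rewrite funeposE /funrpos EFin_max.
  rewrite -expectation_def Upos.
  apply: eq_integral => r; rewrite inE /= in_itv /= andbT => r0; congr (P _).
  apply/seteqP; split => w /=;
    by rewrite !in_itv/= !andbT lt_max (ltNge r 0%R) r0 orbF.
(* The cdf formula is for nonpositive variables, so it is applied to minus the negative part, whose
   cdf agrees with that of [U] at every [r < 0]. *)
transitivity (- \int[P]_w ((- U^\-)%R w)%:E).
  rewrite [in RHS](_ : (fun w => _) = fun w => - ((U^\-)%R w)%:E)//.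
  rewrite integral_ge0N => [|w _]; last by rewrite lee_fin funrneg_ge0.
  rewrite oppeK; apply: eq_integral => w _.
  by rewrite funenegE /funrneg EFin_max.
rewrite -expectation_def Uneg; last first.
  by move=> ?; rewrite oppr_le0 funrneg_ge0.
rewrite oppeK.
apply: eq_integral => r; rewrite inE /= in_itv /= => r0; congr (P _).
apply/seteqP; split => w /=;
  by rewrite !in_itv/= lerNl le_max lerN2 (leNgt _ 0%R) oppr_gt0 r0 orbF.
Qed.

(** A larger tail raises the positive term and, since the cdf is one minus the tail, lowers the
    subtracted one. Allowing two measures covers conditioning on different events. *)
Lemma le_expectation_ccdf d (T : measurableType d) (R : realType)
    (P Q : probability T R) (U : {RV P >-> R}) (V : {RV Q >-> R}) :
  (forall r, ccdf U r <= ccdf V r) -> 'E_P[U] <= 'E_Q[V].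
Proof.
move=> UV; rewrite !expectation_posneg_tail; apply: leeB.
  apply: ge0_le_integral => //.
  - apply: measurable_funTS; exact: ccdf_measurable.
  - apply: measurable_funTS; exact: ccdf_measurable.
apply: ge0_le_integral => //.
- apply: measurable_funTS; exact: cdf_measurable.
- apply: measurable_funTS; exact: cdf_measurable.
by move=> r _; rewrite !cdf_1_ccdf leeB.
Qed.

Lemma le_integral_st_le d (T : measurableType d) (R : realType)
    (P Q : probability T R) (f g : T -> \bar R) :
  measurable_fun setT f -> measurable_fun setT g ->
  (forall w, f w \is a fin_num) -> (forall w, g w \is a fin_num) ->
  st_le P Q f g -> \int[P]_w f w <= \int[Q]_w g w.
Proof.
move=> mf mg finf fing fg.
(* By finiteness, [fine] turns [f] and [g] into real random variables with the same integrals and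
   tails. *)
have mU : measurable_fun setT (fine \o f) by exact: measurableT_comp.
have mV : measurable_fun setT (fine \o g) by exact: measurableT_comp.
pose U : {RV P >-> R} := mfun_Sub (mem_set mU).
pose V : {RV Q >-> R} := mfun_Sub (mem_set mV).
have -> : \int[P]_w f w = 'E_P[U].
  by rewrite expectation_def; apply: eq_integral => w _; rewrite /= fineK.
have -> : \int[Q]_w g w = 'E_Q[V].
  by rewrite expectation_def; apply: eq_integral => w _; rewrite /= fineK.
apply: le_expectation_ccdf => r.
have := fg r; congr (P _ <= Q _); apply/seteqP; split => w /=;
  by rewrite in_itv /= andbT -lte_fin fineK.
Qed.

(** * System lifetimes and conditioning *)

Lemma standby_index_bounds (n k : nat) :
  (1 <= k <= n)%N -> (0 < n - k + 1 <= n)%N.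
Proof. lia. Qed.

Lemma lifetime_fin_num (T : Type) (R : realType) (n k : nat)
    (W : 'I_n -> T -> R) (Z : T -> R) w :
  (1 <= k <= n)%N -> lifetime k W Z w \is a fin_num.
Proof.
move=> kn; rewrite /lifetime.
have [i ->] := ordstat_mem _ _ _ W _ w (standby_index_bounds _ _ kn).
have [j2|j2] := leqP (n - k + 2) n.
  have [|j ->] := ordstat_mem _ _ _ W (n - k + 2) w; first by rewrite j2 addn2.
  by rewrite -EFinD -EFin_min.
(* Here [k = 1]: the second order statistic has index [n + 1], equals [+oo], and drops out of the
   minimum. *)
rewrite [X in Order.min _ X]/ordstat nth_default ?miney//.
by rewrite size_sort size_map size_enum_ord addn2 -ltnS -addn2.
Qed.

Lemma measurable_lifetime d (T : measurableType d) (R : realType) (n k : nat)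
    (W : 'I_n -> T -> R) (Z : T -> R) :
  (forall i, measurable_fun setT (W i)) -> measurable_fun setT Z ->
  measurable_fun setT (lifetime k W Z).
Proof.
move=> mW mZ; apply: measurable_mine.
  apply: emeasurable_funD; last exact/measurable_EFinP.
  by apply: measurable_ordstat => //; rewrite addn1.
by apply: measurable_ordstat => //; rewrite addn2.
Qed.

Lemma measurable_rvec d (T : measurableType d) (R : realType) (n : nat)
    (W : 'I_n -> T -> R) :
  (forall i, measurable_fun setT (W i)) -> measurable_fun setT (rvec W).
Proof.
move=> mW; apply/measurable_fun_tnthP => i.
by apply: eq_measurable_fun (mW i) => w _; rewrite /= tnth_mktuple.
Qed.

Lemma ae_nat_ordstat d (T : measurableType d) (R : realType)
    (P : probability T R) (n : nat) (W : 'I_n -> T -> R) j :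
  (0 < j <= n)%N -> (forall i, nat_valued P (W i)) ->
  {ae P, forall w, exists m : nat, ordstat W j w = m%:R%:E}.
Proof.
move=> jn natW.
have : {ae P, forall w, forall i, exists m : nat, W i w = m%:R%R}.
  exact: filter_forall.
apply: filterS => w Ww; have [i ->] := ordstat_mem _ _ _ W _ w jn.
by have [m ->] := Ww i; exists m.
Qed.

Lemma prob_lifetime_le d (Omega : measurableType d) (R : realType)
    (P : probability Omega R) (n k : nat) (X Y : 'I_n -> {RV P >-> R})
    (Z1 Z2 : {RV P >-> R}) (C : set (n.-tuple R)) (s : R) :
  (1 <= k <= n)%N -> (forall i, nat_valued P (X i)) ->
  eq_dist P (rvec X) (rvec Y) ->
  independent P (rvec X) Z1 -> independent P (rvec Y) Z2 ->
  st_le P P (EFin \o Z1) (EFin \o Z2) -> measurable C ->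
  P ([set w | s%:E < lifetime k X Z1 w] `&` rvec X @^-1` C) <=
  P ([set w | s%:E < lifetime k Y Z2 w] `&` rvec Y @^-1` C).
Proof.
move=> /andP[k1 kn] natX eqXY iX iY leZ mC.
pose h j : n.-tuple R -> \bar R := ordstat (fun i x => tnth x i) j.
have mh j : (0 < j)%N -> measurable_fun setT (h j).
  by move=> j0; apply: measurable_ordstat => // i; exact: measurable_tnth.
have lE (W : 'I_n -> {RV P >-> R}) (Z : {RV P >-> R}) w : lifetime k W Z w =
    Order.min (h (n - k + 1)%N (rvec W w) + (Z w)%:E)
      (h (n - k + 2)%N (rvec W w)).
  by rewrite /h -!ordstat_rvec.
under eq_set do rewrite lE.
under [X in _ <= P (X `&` _)]eq_set do rewrite lE.
apply: prob_standby_le => //; try exact: measurable_rvec.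
- by apply: mh; rewrite addn1.
- by apply: mh; rewrite addn2.
have : {ae P, forall w, exists m : nat, ordstat X (n - k + 1) w = m%:R%:E}.
  by apply: ae_nat_ordstat => //; apply: standby_index_bounds; rewrite k1.
by apply: filterS => w [m]; rewrite ordstat_rvec; exists m.
Qed.

(** Since [P A = P B], conditioning divides both sides of [prob_lifetime_le] by the same number. *)
Lemma cond_lifetime_le d (Omega : measurableType d) (R : realType)
    (P : probability Omega R) (n k : nat) (X Y : 'I_n -> {RV P >-> R})
    (Z1 Z2 : {RV P >-> R}) (C : set (n.-tuple R)) (t : R) :
  (1 <= k <= n)%N -> (forall i, nat_valued P (X i)) ->
  eq_dist P (rvec X) (rvec Y) ->
  independent P (rvec X) Z1 -> independent P (rvec Y) Z2 ->
  st_le P P (EFin \o Z1) (EFin \o Z2) -> measurable C ->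
  let A := rvec X @^-1` C in
  let B := rvec Y @^-1` C in
  0 < P A ->
  st_le (cond_prob P A) (cond_prob P B) (lifetime k X Z1) (lifetime k Y Z2) /\
  \int[cond_prob P A]_w (lifetime k X Z1 w - t%:E) <=
    \int[cond_prob P B]_w (lifetime k Y Z2 w - t%:E).
Proof.
move=> kn natX eqXY iX iY leZ mC A B PA0.
have PAB : P A = P B by exact: eqXY.
have PB0 : 0 < P B by rewrite -PAB.
have mA : measurable A.
  by rewrite -[X in measurable X]setTI; exact: measurable_rvec.
have mB : measurable B.
  by rewrite -[X in measurable X]setTI; exact: measurable_rvec.
have mT (W : 'I_n -> {RV P >-> R}) (Z : {RV P >-> R}) :
    measurable_fun setT (lifetime k W Z) by exact: measurable_lifetime.
have leT : st_le (cond_prob P A) (cond_prob P B) (lifetime k X Z1)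
    (lifetime k Y Z2).
  move=> s; rewrite /cond_prob -PAB lee_wpmul2r//; last exact: prob_lifetime_le.
  by rewrite inve_ge0.
(* Subtracting [t] only shifts the threshold from [s] to [s + t]. *)
have leTt : st_le (cond_prob P A) (cond_prob P B)
    (fun w => lifetime k X Z1 w - t%:E) (fun w => lifetime k Y Z2 w - t%:E).
  move=> s; have := leT (s + t)%R.
  under eq_set do rewrite EFinD -lteBrDr//.
  by under [X in _ <= cond_prob _ _ X]eq_set do rewrite EFinD -lteBrDr//.
(* As a normalized restriction, [cond_prob] is a genuine probability, to which the comparison of
   integrals applies. *)
split=> //; move: leTt; rewrite (cond_probE mA)// (cond_probE mB)// => leTt.
apply: le_integral_st_le.
- by apply: emeasurable_funB.
- by apply: emeasurable_funB.
- by move=> w; rewrite fin_numB lifetime_fin_num.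
- by move=> w; rewrite fin_numB lifetime_fin_num.
exact: leTt.
Qed.

Theorem theorem4p3 (d : measure_display) (Omega : measurableType d)
    (R : realType) (P : probability Omega R)
    (n k : nat) (hk1 : (1 <= k)%N) (hkn : (k <= n)%N)
    (X Y : 'I_n -> {RV P >-> R}) (Z1 Z2 : {RV P >-> R})
    (hX : forall i, nat_valued P (X i))
    (hZ1 : nat_valued P Z1) (hZ2 : nat_valued P Z2)
    (hXY : eq_dist P (rvec X) (rvec Y))
    (hindX : independent P (rvec X) Z1)
    (hindY : independent P (rvec Y) Z2)
    (hZ : st_le P P (EFin \o Z1) (EFin \o Z2)) :
  let T1 := lifetime k X Z1 in
  let T2 := lifetime k Y Z2 in
  (st_le P P T1 T2 /\ \int[P]_w T1 w <= \int[P]_w T2 w) /\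
  (forall t : R,
    let A := [set w | t%:E < ordstat X 1 w] in
    let B := [set w | t%:E < ordstat Y 1 w] in
    0 < P A ->
    st_le (cond_prob P A) (cond_prob P B) T1 T2 /\
    \int[cond_prob P A]_w (T1 w - t%:E) <= \int[cond_prob P B]_w (T2 w - t%:E)) /\
  (forall t : R,
    let A := [set w | t%:E < ordstat X (n - k + 1)%N w] in
    let B := [set w | t%:E < ordstat Y (n - k + 1)%N w] in
    0 < P A ->
    st_le (cond_prob P A) (cond_prob P B) T1 T2 /\
    \int[cond_prob P A]_w (T1 w - t%:E) <= \int[cond_prob P B]_w (T2 w - t%:E)).
Proof.
move=> T1 T2.
have kn : (1 <= k <= n)%N by rewrite hk1.
have leT : st_le P P T1 T2.
  (* The unconditional case takes the whole tuple space for [C]. *)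
  move=> s; rewrite -[X in P X <= _]setIT -[X in _ <= P X]setIT.
  rewrite -[X in _ `&` X](preimage_setT (rvec X)).
  rewrite -[X in _ <= P (_ `&` X)](preimage_setT (rvec Y)).
  exact: prob_lifetime_le.
(* Parts (b) and (c) are the cases [j = 1] and [j = n - k + 1]. *)
have cond j t : (0 < j)%N -> 0 < P [set w | t%:E < ordstat X j w] ->
    st_le (cond_prob P [set w | t%:E < ordstat X j w])
      (cond_prob P [set w | t%:E < ordstat Y j w]) T1 T2 /\
    \int[cond_prob P [set w | t%:E < ordstat X j w]]_w (T1 w - t%:E) <=
    \int[cond_prob P [set w | t%:E < ordstat Y j w]]_w (T2 w - t%:E).
  move=> j0.
  pose C := [set x : n.-tuple R | t%:E < ordstat (fun i y => tnth y i) j x].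
  have mC : measurable C.
    rewrite -[X in measurable X]setTI; apply: emeasurable_fun_o_infty => //.
    by apply: measurable_ordstat => // i; exact: measurable_tnth.
  have CE (W : 'I_n -> {RV P >-> R}) :
      [set w | t%:E < ordstat W j w] = rvec W @^-1` C.
    by apply/seteqP; split => w; rewrite /C /= -ordstat_rvec.
  by rewrite (CE X) (CE Y); exact: cond_lifetime_le.
split; last by split=> t A B; apply: cond => //; rewrite addn1.
split=> //; apply: le_integral_st_le => // [||w|w].
- exact: measurable_lifetime.
- exact: measurable_lifetime.
- exact: lifetime_fin_num.
- exact: lifetime_fin_num.
Qed.
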